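(* Let $\Lambda\in D$ be a right integral and suppose $\epsilon(\Lambda)=1$. Let $V$ be a right representation of $D$, and let $W\subset V$ be a subrepresentation. Then there is a complement $W_o$ of $W$ in $V$ (that is, a subspace with $V=W\oplus W_o$) which is also a right representation of $D$ (a subrepresentation of $V$).
   Context: $X$ is a finite group with identity $e$, $G\subset X$ a subgroup, and $M\subset X$ a set of coset representatives with $e\in M$: every $x\in X$ factors uniquely as $x=us$ with $u\in G$, $s\in M$. For $s,t\in M$ define $\tau(s,t)\in G$ and $s\cdot t\in M$ by $st=\tau(s,t)(s\cdot t)$. It is assumed that $(M,\cdot)$ has left division: for all $s,p\in M$ there is a unique $t\in M$ with $s\cdot t=p$. All vector spaces are finite dimensional over a field $k$. For $y,x\in X$ put $y\,\tilde\triangleleft\, x=x^{-1}yx$. For $v,w\in G$, $t,p\in M$ put $(vt)\circ(wp)=wvtp$ and $\tilde\tau(vt,wp)=\tau(t,p)$. An object of the category $\mathcal{D}$ is an $X$-graded vector space $V=\bigoplus_{y\in X}V_y$ (the grade of a homogeneous $\xi$ is written $\|\xi\|$) with a right $X$-action $\hat\triangleleft$ such that $\|\xi\hat\triangleleft x\|=\|\xi\|\tilde\triangleleft x$; morphisms are linear maps preserving the grading and the action. $D$ is the $k$-vector space with basis $\delta_y\otimes x$ ($x,y\in X$), with grade defined by $y\circ\|\delta_y\otimes x\|=y\tilde\triangleleft x$, product $$(\delta_y\otimes x)(\delta_w\otimes z)=\delta_{w,\,y\tilde\triangleleft x}\ \delta_{y\tilde\triangleleft\tilde\tau(a,b)}\otimes\tilde\tau(a,b)^{-1}xz,\qquad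 a=\|\delta_y\otimes x\|,\ b=\|\delta_w\otimes z\|,$$ and counit $\epsilon(\delta_y\otimes x)=\delta_{y,e}$. (It is a braided Hopf algebra in the braided tensor category $\mathcal{D}$, not associative in the usual sense.) Each object $V$ of $\mathcal{D}$ carries a right action of $D$ given on homogeneous $\xi$ by $\xi\hat\triangleleft(\delta_y\otimes x)=\delta_{y,\|\xi\|}\,\xi\hat\triangleleft x$; right representations of $D$ are the objects of $\mathcal{D}$ with this action, and a subrepresentation is a subspace closed under the action of $D$ (equivalently, an $X$-graded subspace stable under the $X$-action). A right integral in $D$ is a non-zero element $\Lambda\in D$ with $\Lambda h=\epsilon(h)\Lambda$ for all $h\in D$. *)

(* Defs.v *)
From mathcomp Require Import all_boot all_order all_fingroup all_algebra.

Set Implicit Arguments.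
Unset Strict Implicit.
Unset Printing Implicit Defensive.

Import GRing.Theory.
Local Open Scope ring_scope.

Section Factorization.

(* The finite group X is the whole type gT. *)
Variables (gT : finGroupType) (G : {group gT}) (M : {set gT}).

Definition coset_representatives : Prop :=
  (1%g \in M) /\
  forall x : gT, exists! us : gT * gT,
    [/\ us.1 \in G, us.2 \in M & x = (us.1 * us.2)%g].

(* x = gpart x * mpart x with gpart x \in G, and mpart x \in M as soon as M is
   a set of coset representatives (see gpart_mpartP); the default value 1 is
   then never reached. *)
Definition gpart (x : gT) : gT := odflt 1%g [pick u in G | (u^-1 * x)%g \in M].
Definition mpart (x : gT) : gT := ((gpart x)^-1 * x)%g.

Definition tau (s t : gT) : gT := gpart (s * t)%g.
Definition mdot (s t : gT) : gT := mpart (s * t)%g.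

Definition left_division : Prop :=
  {in M &, forall s p : gT, exists! t : gT, t \in M /\ mdot s t = p}.

Definition circ (y a : gT) : gT :=
  (gpart a * gpart y * mpart y * mpart a)%g.

Definition ttau (y a : gT) : gT := tau (mpart y) (mpart a).

(* The grade of the basis element (delta_y (x) x): the solution a of
   circ y a = x^-1 y x, which is unique under left division (see gradeP).
   MathComp's (y ^ x)%g is x^-1 * y * x. *)
Definition grade (y x : gT) : gT := odflt 1%g [pick a | circ y a == (y ^ x)%g].

Lemma gpart_mpartP x : coset_representatives ->
  [/\ gpart x \in G, mpart x \in M & x = (gpart x * mpart x)%g].
Proof.
move=> [_ /(_ x)[[u s] [[/= uG sM def_x] _]]].
rewrite /mpart mulKVg /gpart; case: pickP => [v /andP[] //|/(_ u)].
by rewrite uG def_x mulKg sM.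
Qed.

Lemma gpart_mpart_unique u s : coset_representatives ->
  u \in G -> s \in M -> gpart (u * s)%g = u /\ mpart (u * s)%g = s.
Proof.
move=> cosM uG sM; have [gG mM def_us] := gpart_mpartP (u * s)%g cosM.
have [_ /(_ (u * s)%g)[p [_ p_unique]]] := cosM.
have E1 : p = (u, s) by apply: p_unique.
have E2 : p = (gpart (u * s)%g, mpart (u * s)%g) by apply: p_unique.
by move: E2; rewrite E1 => -[<- <-].
Qed.

Lemma gradeP y x a : coset_representatives -> left_division ->
  (circ y a = (y ^ x)%g) <-> a = grade y x.
Proof.
move=> cosM ldiv; have fac := gpart_mpartP ^~ cosM.
have circE b : circ y b =
    ((gpart b * gpart y * tau (mpart y) (mpart b))
       * mdot (mpart y) (mpart b))%g.
  have [_ _ e] := fac (mpart y * mpart b)%g.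
  by rewrite -mulgA /tau /mdot -e /circ !mulgA.
have circ_inj b c : circ y b = circ y c -> b = c.
  move=> eq_bc; have [bG bM def_b] := fac b; have [cG cM def_c] := fac c.
  have [yG yM _] := fac y.
  have [tbG dbM _] := fac (mpart y * mpart b)%g.
  have [tcG dcM _] := fac (mpart y * mpart c)%g.
  have [_ eq_db] := gpart_mpart_unique cosM
    (groupM (groupM bG yG) tbG : _ \in G) (dbM : mdot _ _ \in M).
  have [_ eq_dc] := gpart_mpart_unique cosM
    (groupM (groupM cG yG) tcG : _ \in G) (dcM : mdot _ _ \in M).
  have eq_d : mdot (mpart y) (mpart b) = mdot (mpart y) (mpart c).
    by rewrite -eq_db -eq_dc -!circE eq_bc.
  have [t [_ t_unique]] := ldiv _ _ yM dcM.
  have eq_m : mpart b = mpart c.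
    by rewrite -(t_unique _ (conj bM eq_d)) -(t_unique _ (conj cM erefl)).
  rewrite def_b def_c eq_m; congr (_ * _)%g; move: eq_bc.
  by rewrite /circ eq_m => /mulIg/mulIg/mulIg.
have [/= yG yM _] := fac y; have [zG zM def_z] := fac (y ^ x)%g.
have solvable_y : exists b, circ y b = (y ^ x)%g.
  have [p [[pM def_p] _]] := ldiv _ _ yM zM.
  have [tG _ def_yp] := fac (mpart y * p)%g.
  pose w := (gpart (y ^ x) * (gpart y * tau (mpart y) p)^-1)%g.
  have wG : w \in G by rewrite groupM ?groupV ?groupM.
  have [eg em] := gpart_mpart_unique cosM wG pM.
  exists (w * p)%g; rewrite circE eg em def_p {1}/w.
  by rewrite -(mulgA _ (gpart y)) mulgKV -def_z.
have gradeE : circ y (grade y x) = (y ^ x)%g.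
  rewrite /grade; case: pickP => [b /eqP //|no_b].
  by have [b /eqP] := solvable_y; rewrite no_b.
split=> [eq_a|-> //]; apply: circ_inj; by rewrite eq_a.
Qed.

End Factorization.

Section BraidedAlgebra.

Variables (gT : finGroupType) (G : {group gT}) (M : {set gT}) (k : fieldType).

(* h : algD is the element \sum_(y, x) h (y, x) (delta_y (x) x). *)
Definition algD : lmodType k := {ffun gT * gT -> k^o}.

Definition basisD (y x : gT) : algD := [ffun p => ((p == (y, x))%:R : k)].

Definition mul_basisD (y x w z : gT) : algD :=
  let t := ttau G M (grade G M y x) (grade G M w z) in
  if w == (y ^ x)%g then basisD (y ^ t)%g (t^-1 * x * z)%g else 0.

Definition coordD (h : algD) (p : gT * gT) : k := (h : {ffun _ -> _}) p.

Definition mulD (h g : algD) : algD :=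
  \sum_(p : gT * gT) \sum_(q : gT * gT)
     (coordD h p * coordD g q) *: mul_basisD p.1 p.2 q.1 q.2.

Definition counitD (h : algD) : k :=
  \sum_(p : gT * gT) coordD h p * (p.1 == 1%g)%:R.

Definition right_integral (L : algD) : Prop :=
  L <> 0 /\ forall h : algD, mulD L h = counitD h *: L.

Lemma coord_basisD y x p : coordD (basisD y x) p = (p == (y, x))%:R.
Proof. by rewrite /coordD ffunE. Qed.

Lemma mulD_basis y x w z :
  mulD (basisD y x) (basisD w z) = mul_basisD y x w z.
Proof.
rewrite /mulD (bigD1 (y, x)) //= [X in _ + X]big1 ?addr0 => [|p /negPf nep].
  rewrite (bigD1 (w, z)) //= big1 => [|q /negPf neq].
    by rewrite !coord_basisD !eqxx mulr1 scale1r addr0.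
  by rewrite !coord_basisD neq mulr0 scale0r.
by apply: big1 => q _; rewrite coord_basisD nep mul0r scale0r.
Qed.

Lemma counitD_basis y x : counitD (basisD y x) = (y == 1%g)%:R.
Proof.
rewrite /counitD (bigD1 (y, x)) //= big1 => [|p /negPf nep].
  by rewrite coord_basisD eqxx mul1r addr0.
by rewrite coord_basisD nep mul0r.
Qed.

End BraidedAlgebra.

Section Representations.

Variables (gT : finGroupType) (k : fieldType).

(* obj_act x v is the right action of x on v, hence the order of the factors
   in obj_actM. *)
Record objD := ObjD {
  obj_space :> vectType k;
  obj_comp : gT -> {vspace obj_space};
  obj_act : gT -> 'End(obj_space);
  obj_sum : fullv = (\sum_(y : gT) obj_comp y)%VS;
  obj_direct : directv (\sum_(y : gT) obj_comp y);
  obj_act1 : forall v, obj_act 1%g v = v;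
  obj_actM : forall x y v, obj_act (x * y)%g v = obj_act y (obj_act x v);
  obj_act_comp : forall x y v,
    v \in obj_comp y -> obj_act x v \in obj_comp (y ^ x)%g
}.

Definition hproj (V : objD) (y : gT) : V -> V := sumv_pi_for (obj_sum V) y.
Arguments hproj : clear implicits.

(* The linear extension of
   xi <| (delta_y (x) x) = delta_{y, ||xi||} xi <| x for homogeneous xi. *)
Definition repD (V : objD) (v : V) (h : algD gT k) : V :=
  \sum_(p : gT * gT) coordD h p *: obj_act V p.2 (hproj V p.1 v).

Definition subrepD (V : objD) (W : {vspace V}) : Prop :=
  forall (w : V) (h : algD gT k), w \in W -> repD w h \in W.

Lemma hproj_homog (V : objD) y z (v : V) :
  v \in obj_comp V z -> hproj V y v = if y == z then v else 0.
Proof.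
move=> vz; pose w i : V := if i == z then v else 0.
have vE : v = \sum_i w i.
  by rewrite (bigD1 z) //= /w eqxx big1 ?addr0 // => i /negPf->.
have wE i : true -> w i \in obj_comp V i.
  by rewrite /w; case: eqP => [->|]; rewrite ?mem0v.
have pE i : true -> hproj V i v \in obj_comp V i.
  by move=> _; apply: memv_sum_pi.
have pv : v = \sum_i hproj V i v.
  by rewrite (sumv_pi_sum (obj_sum V)) ?memvf.
have /directv_sum_unique uniqV := obj_direct V.
have := uniqV (fun i => hproj V i v) w pE wE.
by rewrite -pv -vE eqxx => /esym/forallP/(_ y)/eqP.
Qed.

Lemma repD_homog (V : objD) z (v : V) y x : v \in obj_comp V z ->
  repD v (basisD k y x) = if y == z then obj_act V x v else 0.
Proof.
move=> vz; rewrite /repD (bigD1 (y, x)) //= big1 => [|p /negPf nep].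
  rewrite coord_basisD eqxx scale1r addr0 (hproj_homog _ vz).
  by case: ifP; rewrite ?linear0.
by rewrite coord_basisD nep scale0r.
Qed.

End Representations.

(* Main.v *)
Require Import Defs.
From HB Require Import structures.
From mathcomp Require Import all_boot all_order all_fingroup all_algebra.

(** This is Maschke's theorem; the only point is to see why a normalised
    right integral [L] provides the averaging.

    The elements [delta_1 (x) x] of [D] have grade 1, so no cocycle appears
    in their products and they multiply like the elements [x] of the group
    algebra of [X]. A basis element [delta_y (x) x] with [y != 1] is killed
    by right multiplication by any [delta_1 (x) z]. Hence the equations [L
    (delta_1 (x) z) = L] force the coefficient of [delta_1 (x) x] in [L] to
    be the same scalar [c] for every [x] ([right_integral_coord1]). The
    counit sums these coefficients, so [counitD L = 1] reads [c * #|X| = 1],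
    and the order of [X] is invertible in [k] ([card_neq0_of_integral]).

    Now start from any linear projection [p] of [V] onto [W]. Since [W] is
    graded, the block-diagonal part of [p], obtained by keeping only the
    blocks [V_y -> V_y] ([block_diag]), is still a projection onto [W];
    since [W] is stable under [X], so is the average of the conjugates of
    that block-diagonal part under [X] ([average]). The average commutes
    with [X] and, because the action of [X] permutes the homogeneous
    components, it still commutes with the homogeneous projections. Its
    kernel is the complement sought. *)

Set Implicit Arguments.
Unset Strict Implicit.
Unset Printing Implicit Defensive.

Import GRing.Theory.
Local Open Scope ring_scope.

(** * Right integrals and the order of the group *)

Section Integral.

Variables (gT : finGroupType) (G : {group gT}) (M : {set gT}) (k : fieldType).
Hypotheses (cosM : coset_representatives G M) (ldivM : left_division G M).

Lemma gpart1_mpart1 : gpart G M 1%g = 1%g /\ mpart G M 1%g = 1%g.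
Proof.
have := @gpart_mpart_unique _ G M 1%g 1%g cosM (group1 G) cosM.1.
by rewrite mulg1.
Qed.

Lemma grade1 x : grade G M 1%g x = 1%g.
Proof.
apply/esym/(gradeP 1%g x 1%g cosM ldivM).
by have [e1 e2] := gpart1_mpart1; rewrite /circ e1 e2 !mulg1 conj1g.
Qed.

Lemma mul_basisD1 y x z :
  mul_basisD G M k y x 1%g z = if y == 1%g then basisD k 1%g (x * z)%g else 0.
Proof.
rewrite /mul_basisD (eq_sym 1%g) conjg_eq1; case: eqP => // ->.
have [e1 e2] := gpart1_mpart1.
by rewrite !grade1 /ttau /tau e2 mulg1 e1 conj1g invg1 mul1g.
Qed.

Lemma coordD_sum (I : finType) (F : I -> algD gT k) q :
  coordD (\sum_i F i) q = \sum_i coordD (F i) q.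
Proof. by rewrite /coordD sum_ffunE. Qed.

Lemma coordDZ a (h : algD gT k) q : coordD (a *: h) q = a * coordD h q.
Proof. by rewrite /coordD ffunE. Qed.

Lemma coordD0 q : coordD (0 : algD gT k) q = 0.
Proof. by rewrite -(scale0r 0) coordDZ mul0r. Qed.

Lemma mulD_basisr (h : algD gT k) w z :
  mulD G M h (basisD k w z) =
    \sum_p coordD h p *: mul_basisD G M k p.1 p.2 w z.
Proof.
apply: eq_bigr => p _; rewrite (bigD1 (w, z)) //= big1 => [|q /negPf neq].
  by rewrite coord_basisD eqxx mulr1 addr0.
by rewrite coord_basisD neq mulr0 scale0r.
Qed.

(** Right multiplication by [delta_1 (x) z] acts as in the group algebra on the
    coefficients of first index 1. *)
Lemma coord_mulD_basis1 (h : algD gT k) x z :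
  coordD (mulD G M h (basisD k 1%g z)) (1%g, x) = coordD h (1%g, (x * z^-1)%g).
Proof.
rewrite mulD_basisr coordD_sum (bigD1 (1%g, (x * z^-1)%g)) //= big1.
  by rewrite coordDZ mul_basisD1 eqxx coord_basisD mulgKV eqxx mulr1 addr0.
case=> y u /= neq; rewrite coordDZ mul_basisD1.
case: (eqVneq y 1%g) neq => [->|_ _]; last by rewrite coordD0 mulr0.
rewrite coord_basisD !xpair_eqE !eqxx /= => /negPf neq.
by rewrite -(inj_eq (mulIg z^-1%g)) mulgK eq_sym neq mulr0.
Qed.

(** The element [delta_1 (x) x] has counit 1, so [L] is invariant under the
    translation of coefficients that it induces. *)
Lemma right_integral_coord1 (L : algD gT k) x :
  right_integral G M L -> coordD L (1%g, x) = coordD L (1%g, 1%g).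
Proof.
move=> [_ /(_ (basisD k 1%g x)) L_int]; have := coord_mulD_basis1 L x x.
by rewrite mulgV L_int counitD_basis eqxx scale1r.
Qed.

Lemma counitD_sum1 (h : algD gT k) : counitD h = \sum_x coordD h (1%g, x).
Proof.
rewrite /counitD (eq_bigr (fun p => coordD h (p.1, p.2) * (p.1 == 1%g)%:R)).
  rewrite -(pair_bigA _ (fun y x => coordD h (y, x) * (y == 1%g)%:R)) /=.
  rewrite (bigD1 1%g) //= [X in _ + X]big1 ?addr0 => [|y /negPf ne1].
    by apply: eq_bigr => x _; rewrite eqxx mulr1.
  by apply: big1 => x _; rewrite ne1 mulr0.
by case.
Qed.

Lemma card_neq0_of_integral (L : algD gT k) :
  right_integral G M L -> counitD L = 1 -> (#|gT|%:R : k) != 0.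
Proof.
move=> intL; rewrite counitD_sum1.
under eq_bigr => x _ do rewrite right_integral_coord1 //.
rewrite sumr_const => epsL; apply/eqP => card0.
by move: epsL; rewrite -mulr_natr card0 mulr0 => /esym/eqP; rewrite oner_eq0.
Qed.

End Integral.

(** * Homogeneous projections and subrepresentations *)

Section GradedActions.

Variables (gT : finGroupType) (k : fieldType) (V : objD gT k).
Implicit Types (v : V) (W : {vspace V}).

HB.instance Definition _ (y : gT) := GRing.Linear.copy (hproj (V := V) y)
  (fun_of_lfun (sumv_pi_for (obj_sum V) y)).

Lemma memv_hproj y v : hproj (V := V) y v \in obj_comp V y.
Proof. exact: memv_sum_pi. Qed.

Lemma sum_hproj v : \sum_y hproj (V := V) y v = v.
Proof. by rewrite (sumv_pi_sum (obj_sum V)) ?memvf. Qed.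

Lemma hproj_id y z v :
  hproj y (hproj (V := V) z v) = if y == z then hproj z v else 0.
Proof. exact/hproj_homog/memv_hproj. Qed.

Lemma hproj_act y x v :
  hproj (V := V) (y ^ x)%g (obj_act V x v) = obj_act V x (hproj y v).
Proof.
rewrite -{1}(sum_hproj v) !linear_sum (bigD1 y) //= big1 => [|z /negPf nezy].
  by rewrite (hproj_homog _ (obj_act_comp x (memv_hproj y v))) eqxx addr0.
rewrite (hproj_homog _ (obj_act_comp x (memv_hproj z v))).
by rewrite (inj_eq (@conjg_inj _ x)) eq_sym nezy.
Qed.

Lemma repD_basis v y x : repD v (basisD k y x) = obj_act V x (hproj y v).
Proof.
rewrite /repD (bigD1 (y, x)) //= big1 => [|p /negPf nep].
  by rewrite coord_basisD eqxx scale1r addr0.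
by rewrite coord_basisD nep scale0r.
Qed.

Lemma subrepD_hproj W y w : subrepD W -> w \in W -> hproj y w \in W.
Proof.
move=> subW /(subW w (basisD k y 1%g)).
by rewrite repD_basis obj_act1.
Qed.

Lemma subrepD_act W x w : subrepD W -> w \in W -> obj_act V x w \in W.
Proof.
move=> subW wW; rewrite -(sum_hproj w) linear_sum memv_suml // => y _ /=.
by rewrite -repD_basis subW.
Qed.

Lemma subrepD_lker (p : 'End(V)) :
    (forall x v, p (obj_act V x v) = obj_act V x (p v)) ->
    (forall y v, p (hproj y v) = hproj y (p v)) ->
  subrepD (lker p).
Proof.
move=> p_act p_hproj v h; rewrite !memv_ker => /eqP pv0.
rewrite /repD linear_sum big1 //= => q _.
by rewrite linearZ /= p_act p_hproj pv0 !linear0.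
Qed.

End GradedActions.

Lemma lker_complement (k : fieldType) (V : vectType k) (W : {vspace V})
    (p : 'End(V)) :
    (forall v, p v \in W) -> {in W, forall w, p w = w} ->
  (W + lker p)%VS = fullv /\ directv (W + lker p).
Proof.
move=> p_in p_id; split.
  apply/eqP; rewrite eqEsubv subvf; apply/subvP => v _.
  rewrite -(subrKC (p v) v) memv_add // memv_ker linearB /=.
  by rewrite (p_id _ (p_in v)) subrr.
apply/directv_addP/eqP; rewrite -subv0; apply/subvP => v.
by rewrite memv_cap memv_ker memv0 => /andP[/p_id->].
Qed.

(** * Averaging a projection *)

Section Averaging.

Variables (gT : finGroupType) (k : fieldType) (V : objD gT k).

Definition block_diag (p : 'End(V)) : 'End(V) :=
  \sum_y (sumv_pi_for (obj_sum V) y \o p \o sumv_pi_for (obj_sum V) y)%VF.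

Definition average (p : 'End(V)) : 'End(V) :=
  #|gT|%:R^-1 *:
    \sum_x (obj_act V x^-1%g \o block_diag p \o obj_act V x)%VF.

Lemma block_diagE p v : block_diag p v = \sum_y hproj y (p (hproj y v)).
Proof. by rewrite sum_lfunE; apply: eq_bigr => y _; rewrite !comp_lfunE. Qed.

Lemma averageE p v : average p v =
  #|gT|%:R^-1 *: \sum_x obj_act V x^-1%g (block_diag p (obj_act V x v)).
Proof.
rewrite scale_lfunE sum_lfunE; congr (_ *: _).
by apply: eq_bigr => x _; rewrite !comp_lfunE.
Qed.

Lemma block_diag_hproj p y v :
  block_diag p (hproj y v) = hproj y (block_diag p v).
Proof.
rewrite !block_diagE linear_sum; apply: eq_bigr => z _ /=.
by rewrite !hproj_id eq_sym; case: eqP => [->//|_]; rewrite !linear0.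
Qed.

(** The [x]-th conjugate carries [V_y] through [V_(y ^ x)] and back, so it is
    enough that [block_diag p] preserves every component. *)
Lemma average_hproj p y v : average p (hproj y v) = hproj y (average p v).
Proof.
rewrite !averageE linearZ /=; congr (_ *: _); rewrite linear_sum.
apply: eq_bigr => x _ /=; rewrite -hproj_act block_diag_hproj.
by rewrite -[in RHS](conjgK x y) hproj_act.
Qed.

Lemma average_act p z v :
  average p (obj_act V z v) = obj_act V z (average p v).
Proof.
rewrite !averageE linearZ /=; congr (_ *: _); rewrite linear_sum.
rewrite (reindex_inj (mulgI z^-1%g)); apply: eq_bigr => x _ /=.
by rewrite -!obj_actM mulKVg invMg invgK obj_actM.
Qed.

Variables (W : {vspace V}) (p : 'End(V)).
Hypotheses (subW : subrepD W) (p_in : forall v, p v \in W).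

Lemma average_in v : average p v \in W.
Proof.
rewrite averageE memvZ // memv_suml // => x _; apply: subrepD_act => //.
by rewrite block_diagE memv_suml // => y _; apply: subrepD_hproj.
Qed.

Hypothesis p_id : {in W, forall w, p w = w}.

Lemma block_diag_id : {in W, forall w, block_diag p w = w}.
Proof.
move=> w wW; rewrite block_diagE -[RHS]sum_hproj; apply: eq_bigr => y _.
by rewrite p_id ?subrepD_hproj // hproj_id eqxx.
Qed.

Lemma average_id : (#|gT|%:R : k) != 0 -> {in W, forall w, average p w = w}.
Proof.
move=> card_n0 w wW; rewrite averageE (eq_bigr (fun=> w)) => [|x _].
  by rewrite sumr_const -scaler_nat scalerA mulVf ?scale1r.
by rewrite block_diag_id ?subrepD_act // -obj_actM mulgV obj_act1.
Qed.

End Averaging.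

(** Maschke's theorem for graded representations: the hypothesis on [#|gT|] is
    what makes [average] the identity on [W]. *)
Lemma subrepD_complement (gT : finGroupType) (k : fieldType) (V : objD gT k)
    (W : {vspace V}) :
    (#|gT|%:R : k) != 0 -> subrepD W ->
  exists Wo : {vspace V},
    [/\ (W + Wo)%VS = fullv, directv (W + Wo) & subrepD Wo].
Proof.
move=> card_n0 subW.
have p_in v : projv W v \in W := memv_proj W v.
have p_id : {in W, forall w, projv W w = w} by move=> w; apply: projv_id.
have [sumW dirW] := lker_complement
  (average_in subW p_in) (average_id subW p_id card_n0).
exists (lker (average (projv W))); split=> //.
apply: subrepD_lker => [x v|y v]; [exact: average_act | exact: average_hproj].
Qed.

Theorem proposition3p5 (gT : finGroupType) (G : {group gT}) (M : {set gT})
    (k : fieldType)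
    (hM : coset_representatives G M) (hdiv : left_division G M)
    (L : algD gT k) (hL : right_integral G M L) (hL1 : counitD L = 1)
    (V : objD gT k) (W : {vspace V}) (hW : subrepD W) :
  exists Wo : {vspace V},
    [/\ (W + Wo)%VS = fullv, directv (W + Wo) & subrepD Wo].
Proof.
exact: subrepD_complement (card_neq0_of_integral hM hdiv hL hL1) hW.
Qed.
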